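(* Let $\mathcal{T}$ be a locally finite, infinite rooted tree satisfying $\mathrm{IBN}(\mathcal{T})=\alpha\in(0,1)$. Then $\lambda_c(\mathcal{T})=\mathrm{IBN}(\mathcal{T})$; that is, for $\gamma\in(0,1)$, $\mathcal{T}$ satisfies intermediate containment of rate $\gamma$ if $\gamma>\alpha$, and does not satisfy intermediate containment of rate $\gamma$ if $\gamma<\alpha$.
   Context: Firefighting game: let $\mathcal{G}=(V,E)$ be a locally finite, connected, infinite graph and $g=(g_n)_{n\ge1}$ a sequence of nonnegative integers. An initial fire is a finite set $Z_0\subset V$; put $W_0=\emptyset$. At round $n\ge1$ one picks $S_n\subset V\setminus(Z_{n-1}\cup W_{n-1})$ with $\#S_n\le g_n$, and sets $$W_n=W_{n-1}\cup S_n,\qquad Z_n=Z_{n-1}\cup\{v\in V\setminus W_n:\ \exists u\in Z_{n-1},\ u\sim v\}.$$ The fire is contained if $\#\bigcup_{n\ge0}Z_n<\infty$. The graph $\mathcal{G}$ is $g$-containable if for every finite $Z_0\subset V$ there is a choice of sets $(S_n)_{n\ge1}$ with $S_n\subset V\setminus(Z_{n-1}\cup W_{n-1})$ and $\#S_n\le g_n$ for every $n\ge1$ for which the fire is contained. For $\gamma\in(0,1)$, $\mathcal{G}$ satisfies intermediate containment of rate $\gamma$ if there are $C>0$ and $g=(g_n)$ with $g_n\le C\exp(n^{\gamma})$ for all $n\in\mathbb{N}$ such that $\mathcal{G}$ is $g$-containable. The critical parameter $\lambda_c(\mathcal{G})$ is the number such that $\mathcal{G}$ satisfies intermediate containment of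 rate $\gamma$ if $\gamma>\lambda_c$ and does not if $\gamma<\lambda_c$. For a rooted tree $\mathcal{T}=(V,E,\varrho)$, $|v|$ is the graph distance from $v$ to the root; for an edge $e$ with endpoints $e^-,e^+$ where $|e^+|=|e^-|+1$, put $|e|=|e^+|$. A cutset is a set $\pi\subset E$ such that every infinite self-avoiding path from $\varrho$ to infinity has exactly one edge in $\pi$; $\Pi$ is the set of all cutsets. The intermediate branching number is $$\mathrm{IBN}(\mathcal{T})=\sup\Big\{\lambda>0:\ \inf_{\pi\in\Pi}\sum_{e\in\pi}\exp(-|e|^{\lambda})>0\Big\},$$ with $\sup\emptyset=0$. *)

(* Defs.v *)
From HB Require Import structures.
From mathcomp Require Import all_boot all_order all_algebra.
From mathcomp Require Import all_classical all_reals all_analysis.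

Set Implicit Arguments.
Unset Strict Implicit.
Unset Printing Implicit Defensive.

Import Order.TTheory GRing.Theory Num.Theory.

Local Open Scope classical_set_scope.
Local Open Scope card_scope.
Local Open Scope ring_scope.

Section Graphs.
Variables (V : choiceType) (adj : rel V).

Definition simple_graph : Prop := symmetric adj /\ irreflexive adj.

Definition locally_finite : Prop := forall v, finite_set [set u | adj v u].

Definition walk (u v : V) (n : nat) : Prop :=
  exists p : seq V, [/\ path adj u p, last u p = v & size p = n].

Definition graph_connected : Prop := forall u v, exists n, walk u v n.

(* In a simple graph no cycle has size 1, and [:: u; v] is a
   [ucycle] as soon as u and v are adjacent: genuine cycles have size >= 3. *)
Definition acyclic : Prop := forall p : seq V, ucycle adj p -> (size p <= 2)%N.

Definition is_tree : Prop := [/\ simple_graph, graph_connected & acyclic].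

(* The default value 0 is only used when u and v are not connected. *)
Definition gdist (u v : V) : nat :=
  xget 0%N [set n | walk u v n /\ forall m, walk u v m -> (n <= m)%N].

End Graphs.

Section Firefighting.
Variables (V : choiceType) (adj : rel V).

(* [S n] is the set of vertices protected at round n; [S 0] is never used. *)
Fixpoint protected (S : nat -> set V) (n : nat) : set V :=
  if n is m.+1 then protected S m `|` S m.+1 else set0.

Fixpoint fire (Z0 : set V) (S : nat -> set V) (n : nat) : set V :=
  if n is m.+1 then
    fire Z0 S m `|`
    [set v | ~ protected S m.+1 v /\ exists2 u, fire Z0 S m u & adj u v]
  else Z0.

Definition legal (g : nat -> nat) (Z0 : set V) (S : nat -> set V) : Prop :=
  forall n, S n.+1 `<=` ~` (fire Z0 S n `|` protected S n) /\
            S n.+1 #<= `I_(g n.+1).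

Definition contained (Z0 : set V) (S : nat -> set V) : Prop :=
  finite_set (\bigcup_n fire Z0 S n).

Definition containable (g : nat -> nat) : Prop :=
  forall Z0 : set V, finite_set Z0 ->
    exists S : nat -> set V, legal g Z0 S /\ contained Z0 S.

Definition intermediate_containment (R : realType) (gamma : R) : Prop :=
  exists (C : R) (g : nat -> nat),
    [/\ 0 < C,
        forall n : nat, (1 <= n)%N -> (g n)%:R <= C * expR (n%:R `^ gamma)
      & containable g].

Definition is_critical_parameter (R : realType) (l : R) : Prop :=
  forall gamma : R, 0 < gamma -> gamma < 1 ->
    (l < gamma -> intermediate_containment gamma) /\
    (gamma < l -> ~ intermediate_containment gamma).

(* As only rates in (0, 1) are tested, the critical parameter is sought in
   [0, 1]; containment is monotone in the rate, so exactly one number in that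
   interval qualifies and the default value of [xget] plays no role. *)
Definition lambda_c (R : realType) : R :=
  xget 0 [set l : R | [/\ 0 <= l, l <= 1 & is_critical_parameter l]].

End Firefighting.

Section BranchingNumber.
Variables (V : choiceType) (adj : rel V) (root : V).

Definition depth (v : V) : nat := gdist adj root v.

(* The edge with endpoints e^- and e^+ is encoded as the pair (e^-, e^+), the
   only one of its two orientations which points away from the root. *)
Definition edges : set (V * V) :=
  [set e | adj e.1 e.2 /\ depth e.2 = (depth e.1).+1].

Definition edge_depth (e : V * V) : nat := depth e.2.

Definition ray (x : nat -> V) : Prop :=
  [/\ x 0%N = root, forall n, adj (x n) (x n.+1) & injective x].

Definition on_ray (x : nat -> V) (e : V * V) : Prop :=
  exists n, e = (x n, x n.+1) \/ e = (x n.+1, x n).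

Definition cutset (pi : set (V * V)) : Prop :=
  pi `<=` edges /\
  forall x, ray x -> exists! e : V * V, pi e /\ on_ray x e.

Definition cutset_inf (R : realType) (l : R) : \bar R :=
  ereal_inf [set (\esum_(e in pi) (expR (- ((edge_depth e)%:R `^ l)))%:E)%R
            | pi in cutset].

(* [maxe 0] only implements the convention sup set0 = 0: the set consists of
   positive numbers. *)
Definition IBN (R : realType) : \bar R :=
  maxe 0%E (ereal_sup [set l%:E | l in [set l : R | 0 < l /\
                                        (0 < cutset_inf l)%E]]).

End BranchingNumber.

(* Main.v *)
Require Import Defs.
From HB Require Import structures.
From mathcomp Require Import all_boot all_order all_algebra.
From mathcomp Require Import all_classical all_reals all_analysis.
From mathcomp Require Import finmap.
From mathcomp Require Import zify ring lra.

Set Implicit Arguments.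
Unset Strict Implicit.
Unset Printing Implicit Defensive.

Import Order.TTheory GRing.Theory Num.Theory.

Local Open Scope classical_set_scope.
Local Open Scope card_scope.
Local Open Scope ring_scope.

(** In a tree, fighting a fire that starts near the root amounts to choosing a
cutset, and the only time pressure is this: a fire filling the ball of radius
[r] at time 0 gets to a vertex of depth [n + r] at round [n] at the earliest, and
exactly then if nothing on the way is protected, so the heads of the edges of
the cutset at depth [n + r] have to be protected by round [n]. Below,
[f_gamma e = exp (- |e|^gamma)].

Containment above the branching number ([containment_of_cutset_inf]). When the
cutset sums of [f_gamma] have infimum 0, take a cutset of sum below
[exp (- r^gamma)]. All its edges are deeper than [r], and it has at most
[exp ((n + r)^gamma - r^gamma) <= exp (n^gamma)] edges at depth [n + r], because
[x^gamma] is subadditive. So at round [n] one can afford to protect all the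
heads at depth [n + r], just in time; the fire then never leaves the part of the
tree cut off by the cutset, which is finite by Koenig's lemma.

No containment below it ([cutset_inf_of_containment]). Let [gamma < l], and let a
strategy with [g_n <= C exp (n^gamma)] contain the fire starting from the ball of
radius [r]. The edges whose head is the first protected vertex on the path from
the root form a cutset, since an unprotected ray would burn entirely. A head
protected at round [n] has depth at least [n + r], since otherwise it would
already be burning; hence the sum of [f_l] over this cutset is at most the sum
over [n] of [C exp (n^gamma - (n + r)^l)], which tends to 0 as [r] grows
([shifted_sum_small]). So the infimum of the cutset sums is 0.

Applied on either side of [alpha], these two facts locate the threshold at
[alpha]; two numbers of [[0, 1]] cannot both be thresholds, since a rate strictly
between them would be both achievable and not, which identifies [lambda_c]. *)

(** * Depth and rays in a tree *)

Section Depth.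
Variables (V : choiceType) (adj : rel V) (root : V).
Hypothesis conn : graph_connected adj.

Local Notation depth := (depth adj root).

Lemma depth_min v :
  walk adj root v (depth v) /\ forall m, walk adj root v m -> (depth v <= m)%N.
Proof.
rewrite /Defs.depth /gdist.
apply: (@xgetPex _ 0%N
  [set n | walk adj root v n /\ forall m, walk adj root v m -> (n <= m)%N]).
have [n wn] := conn root v.
have ex : exists n, `[< walk adj root v n >] by exists n; apply/asboolP.
case: (ex_minnP ex) => m /asboolP wm mmin; exists m; split=> // k wk.
by apply: mmin; apply/asboolP.
Qed.

Lemma depth_root : depth root = 0%N.
Proof.
by apply/eqP; rewrite -leqn0; apply: (depth_min root).2; exists [::].
Qed.

Lemma depth0_root v : depth v = 0%N -> v = root.
Proof. by move=> d0; have [[[|a p] [_ lp]]] := depth_min v; rewrite d0. Qed.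

Lemma depth_adj u v : adj u v -> (depth v <= (depth u).+1)%N.
Proof.
move=> uv; have [[p [pp lp sp]] _] := depth_min u.
apply: (depth_min v).2; exists (rcons p v).
by rewrite rcons_path last_rcons size_rcons lp pp sp.
Qed.

Lemma depth_parent v n : depth v = n.+1 -> exists2 u, adj u v & depth u = n.
Proof.
move=> dv; have [[p]] := depth_min v; rewrite dv.
case/lastP: p => [[_ _ //]|p w]; rewrite rcons_path last_rcons size_rcons.
move=> [/andP[pp pw] ewv [sp]] _; rewrite {w}ewv in pw *; exists (last root p) => //.
have le1 : (depth (last root p) <= n)%N by apply: (depth_min _).2; exists p.
by have := depth_adj pw; lia.
Qed.

End Depth.

Section Tree.
Variables (V : choiceType) (adj : rel V) (root : V).
Hypothesis tree : is_tree adj.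

Local Notation depth := (depth adj root).

Lemma tree_connected : graph_connected adj. Proof. by case: tree. Qed.
Lemma tree_adjC : symmetric adj. Proof. by case: tree => -[]. Qed.

(** The one use of acyclicity. A simple path that starts and ends at depth [d]
without passing above that depth is extended at both ends by parents until the
two ends meet, at the latest at the root, where it closes up into a cycle. It
yields both that adjacent vertices never have the same depth and that parents
are unique. *)
Lemma no_arch d u q : path adj u q -> uniq (u :: q) -> (0 < size q)%N ->
  depth u = d -> depth (last u q) = d ->
  (forall x, x \in u :: q -> (d <= depth x)%N) -> False.
Proof.
elim: d u q => [|d IHd] u q pq uq sq du dl above.
  have : u = last u q.
    by rewrite [RHS](depth0_root tree_connected dl) (depth0_root tree_connected du).
  case: q uq sq {pq du dl above} => // a q /andP[uq _] _ ulast.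
  by move: uq; rewrite {1}ulast /= mem_last.
have [u' u'u du'] := depth_parent tree_connected du.
have [w' w'w dw'] := depth_parent tree_connected dl.
have notin x : depth x = d -> x \notin u :: q.
  by move=> dx; apply/negP => /above; rewrite dx ltnn.
have [eq_uw|neq_uw] := eqVneq u' w'.
  case: tree => _ _ /(_ (u' :: u :: q)).
  rewrite /ucycle /ucycleb cons_uniq uq notin // andbT /= !rcons_path u'u pq /=.
  by rewrite eq_uw tree_adjC w'w => /(_ isT); case: (q) sq.
have uniq_uw : uniq (u' :: rcons (u :: q) w').
  by rewrite cons_uniq rcons_uniq mem_rcons in_cons negb_or neq_uw !notin.
apply: (IHd u' (rcons (u :: q) w')) => //.
- by rewrite rcons_path /= u'u pq tree_adjC.
- by rewrite last_rcons.
move=> x; rewrite in_cons => /orP[/eqP->|]; first by rewrite du'.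
rewrite mem_rcons in_cons => /orP[/eqP->|/above]; first by rewrite dw'.
exact: ltnW.
Qed.

Lemma tree_adj u v : adj u v -> edges adj root (u, v) \/ edges adj root (v, u).
Proof.
move=> uv; have vu : adj v u by rewrite tree_adjC.
have dvu := depth_adj root tree_connected uv.
have duv := depth_adj root tree_connected vu; rewrite /edges /=.
have [eq_d|] := eqVneq (depth u) (depth v); last by lia.
exfalso; apply: (@no_arch (depth u) u [:: v]) => //=; rewrite ?uv //.
  rewrite inE andbT; apply/negP => /eqP uv'.
  by case: tree => -[_ irr] _ _; move: uv; rewrite uv' irr.
by move=> x; rewrite !inE => /orP[] /eqP-> //; rewrite eq_d.
Qed.

Lemma parent_uniq u1 u2 v :
  edges adj root (u1, v) -> edges adj root (u2, v) -> u1 = u2.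
Proof.
move=> [/= a1 d1] [/= a2 d2]; apply/eqP/negPn/negP => neq.
apply: (@no_arch (depth u1) u1 [:: v; u2]) => //=; rewrite ?a1 ?(tree_adjC v) ?a2 //.
- rewrite !inE negb_or neq !andbT; apply/andP; split; apply/eqP => eqv.
    by move: d1; rewrite -eqv; lia.
  by move: d2; rewrite -eqv; lia.
- lia.
- by move=> x; rewrite !inE => /or3P[] /eqP-> //; lia.
Qed.

(** A ray cannot step back towards the root: the first backward step would lead
to the unique parent, which is the vertex it has just left. *)
Lemma ray_edge x n : ray adj root x -> edges adj root (x n, x n.+1).
Proof.
move=> [x0 adjx injx]; elim: n => [|n IHn].
  have [//|[_ /=]] := tree_adj (adjx 0%N).
  by rewrite x0 (depth_root root tree_connected).
have [//|back] := tree_adj (adjx n.+1).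
by have /injx := parent_uniq IHn back; lia.
Qed.

Lemma ray_depth x n : ray adj root x -> depth (x n) = n.
Proof.
move=> rx; elim: n => [|n IHn]; last by have [_ /= ->] := ray_edge n rx; rewrite IHn.
by have [-> _ _] := rx; exact: (depth_root root tree_connected).
Qed.

Lemma on_ray_edge x e : ray adj root x -> edges adj root e ->
  on_ray x e <-> exists n, e = (x n, x n.+1).
Proof.
move=> rx ee; split; last by move=> [n ->]; exists n; left.
move=> [n [->|ex]]; first by exists n.
by move: ee; rewrite ex => -[/= _]; rewrite !ray_depth //; lia.
Qed.

Lemma descending_ray x : x 0%N = root ->
  (forall n, edges adj root (x n, x n.+1)) -> ray adj root x.
Proof.
move=> x0 ex; split=> // [n|]; first by have [] := ex n.
have dx n : depth (x n) = n.
  elim: n => [|n IHn]; first by rewrite x0 (depth_root root tree_connected).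
  by have [_ /= ->] := ex n; rewrite IHn.
by move=> m n /(congr1 depth); rewrite !dx.
Qed.

(** * Cutsets made of first crossings, and Koenig's lemma *)

(** [reach B u] collects the descendants of [u] that can be joined to [u] without
crossing an edge of [B]; moves are allowed away from the root only. *)
Definition step (B : set (V * V)) : rel V :=
  fun u v => `[< edges adj root (u, v) /\ ~ B (u, v) >].

Definition reach (B : set (V * V)) (u : V) : set V :=
  [set v | exists2 p, path (step B) u p & v = last u p].

Lemma reach_refl B u : reach B u u.
Proof. by exists [::]. Qed.

Lemma reachS B u v w :
  reach B u v -> edges adj root (v, w) -> ~ B (v, w) -> reach B u w.
Proof.
move=> [p pp ->] evw nB; exists (rcons p w); rewrite ?last_rcons // rcons_path pp.
exact/asboolP.
Qed.

Lemma reach_parent B v w :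
  reach B root w -> edges adj root (v, w) -> reach B root v /\ ~ B (v, w).
Proof.
move=> [p]; case/lastP: p => [_ -> [_ /=]|p z].
  by rewrite (depth_root root tree_connected).
rewrite rcons_path last_rcons => /andP[pp /asboolP[ez nB]] -> evz.
by rewrite (parent_uniq evz ez); split=> //; exists p.
Qed.

Lemma reach_ray B x n : ray adj root x ->
  reach B root (x n) <-> forall m, (m < n)%N -> ~ B (x m, x m.+1).
Proof.
move=> rx; have x0 : x 0%N = root by case: rx.
elim: n => [|n IHn]; first by split=> // _; rewrite x0; exact: reach_refl.
split=> [/reach_parent/(_ (ray_edge n rx))[/IHn reach_n nB] m|nB].
  by rewrite ltnS leq_eqVlt => /orP[/eqP->|/reach_n].
apply: reachS (ray_edge n rx) (nB _ (ltnSn n)).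
by apply/IHn => m mn; apply: nB; exact: ltnW.
Qed.

Definition first_cut (B : set (V * V)) : set (V * V) :=
  [set e | [/\ edges adj root e, reach B root e.1 & B e]].

Lemma first_cut_cutset B :
  (forall x, ray adj root x -> exists n, B (x n, x n.+1)) ->
  cutset adj root (first_cut B).
Proof.
move=> hit; split=> [e []//|x rx].
have ex : exists n, `[< B (x n, x n.+1) >].
  by have [n Bn] := hit x rx; exists n; apply/asboolP.
case: (ex_minnP ex) => n /asboolP Bn nmin.
have lt_nB m : (m < n)%N -> ~ B (x m, x m.+1).
  by move=> mn Bm; have := nmin m; rewrite asboolT // leqNgt mn => /(_ isT).
exists (x n, x n.+1); split.
  split; last by exists n; left.
  by split=> //; [exact: ray_edge|apply/reach_ray].
move=> e [[ee re Be] /(on_ray_edge rx ee)[m em]]; subst e.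
move: re => /(reach_ray _ _ rx) re.
have [/re//|/lt_nB//|->//] := ltngtP n m.
Qed.

Hypothesis lfin : locally_finite adj.

Lemma reach_child B u w : reach B u w ->
  u = w \/ exists v, step B u v /\ reach B v w.
Proof.
move=> [[|v p] /=]; first by move=> _ ->; left.
by move=> /andP[uv pp] ->; right; exists v; split=> //; exists p.
Qed.

(** Koenig's lemma: by local finiteness, a vertex with infinitely many reachable
descendants has a child with the same property, and iterating this from the root
traces a ray. *)
Lemma konig B : infinite_set (reach B root) ->
  exists2 x, ray adj root x & forall n, ~ B (x n, x n.+1).
Proof.
move=> inf_root.
pose T := {u : V | infinite_set (reach B u)}.
have next (t : T) : {s : T | step B (sval t) (sval s)}.
  apply: cid; case: t => u inf_u; apply: contrapT => none; apply: (inf_u).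
  have sub : reach B u `<=` [set u] `|` \bigcup_(v in step B u) reach B v.
    by move=> w /reach_child[->|[v [uv vw]]]; [left|right; exists v].
  apply: (sub_finite_set sub); rewrite finite_setU; split; first exact: finite_set1.
  apply: bigcup_finite => [|v uv].
    by apply: sub_finite_set (lfin u) => v /asboolP[[]].
  by apply: contrapT => inf_v; apply: none; exists (exist _ v inf_v).
have [f [f0 fS]] := dependent_choice next (exist _ root inf_root).
exists (fun n => sval (f n)) => [|n]; last by have /asboolP[] := fS n.
by apply: descending_ray => [|n]; [rewrite f0|have /asboolP[] := fS n].
Qed.

Lemma finite_ball r : finite_set [set v | (depth v <= r)%N].
Proof.
elim: r => [|r IHr].
  apply: (@sub_finite_set _ _ [set root]) => [v /=|]; last exact: finite_set1.
  by rewrite leqn0 => /eqP /(depth0_root tree_connected).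
have sub : [set v | (depth v <= r.+1)%N] `<=`
    [set root] `|` \bigcup_(u in [set u | (depth u <= r)%N]) [set v | adj u v].
  move=> v /= dv; case dvE : (depth v) => [|n].
    by left; exact: (depth0_root tree_connected).
  have [u uv du] := depth_parent tree_connected dvE.
  by right; exists u => //=; move: dv; rewrite dvE du.
apply: (sub_finite_set sub); rewrite finite_setU; split; first exact: finite_set1.
by apply: bigcup_finite IHr _ => u _; exact: lfin.
Qed.

End Tree.

(** * Stretched exponentials *)

Section StretchedExponential.
Variable R : realType.
Implicit Types a b gamma l : R.

(** With [gamma <= 1] the factor [x `^ (gamma - 1)] is nonincreasing, so each term
of [(a + b) `^ gamma = (a + b) * (a + b) `^ (gamma - 1)] is bounded separately. *)
Lemma powR_subadditive a b gamma : 0 <= a -> 0 <= b -> 0 < gamma -> gamma <= 1 ->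
  (a + b) `^ gamma <= a `^ gamma + b `^ gamma.
Proof.
move=> a0 b0 g0 g1; have [ab0|ab_gt0] := eqVneq (a + b) 0.
  by rewrite ab0 powR0 ?gt_eqF// addr_ge0 ?powR_ge0.
have {ab_gt0}ab_gt0 : 0 < a + b by rewrite lt_neqAle eq_sym ab_gt0 addr_ge0.
have low x : 0 <= x -> x <= a + b -> x * (a + b) `^ (gamma - 1) <= x `^ gamma.
  move=> x0 xab; have [->|xn0] := eqVneq x 0; first by rewrite mul0r powR_ge0.
  rewrite -[leRHS]mulr_powRB1// ler_wpM2l// -(opprB 1) !powRN.
  rewrite lef_pV2 ?posrE ?powR_gt0//.
    by rewrite ge0_ler_powR ?nnegrE ?subr_ge0 ?(ltW ab_gt0).
  by rewrite lt_neqAle eq_sym xn0.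
rewrite -[leLHS]mulr_powRB1 ?(ltW ab_gt0)// mulrDl lerD// low//; lra.
Qed.

(** As soon as [m `^ (l - gamma) >= 2] the left-hand side is at most
[exp (- m `^ gamma)], which decays faster than every power of [m]. *)
Lemma expR_stretched_gap gamma l : 0 < gamma -> gamma < l ->
  exists A : R, 0 < A /\ exists m0 : nat, forall m, (m0 < m)%N ->
    expR (m%:R `^ gamma) * expR (- m%:R `^ l) <= A / m%:R ^+ 2.
Proof.
move=> g0 gl; have d0 : 0 < l - gamma by rewrite subr_gt0.
pose N := (Num.truncn (2 / gamma)).+1.
have N0 : (0 : R) < N%:R by rewrite ltr0n.
have gN : 2 <= gamma * N%:R.
  by rewrite -ler_pdivrMl// mulrC ltW// truncnS_gt.
exists (N%:R ^+ N); split; first exact: exprn_gt0.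
exists (Num.truncn ((2 : R) `^ (l - gamma)^-1)) => m mm.
have m_ge : (2 : R) `^ (l - gamma)^-1 <= m%:R.
  by apply/ltW; apply: lt_le_trans (truncnS_gt _) _; rewrite ler_nat.
have m0 : (0 : R) < m%:R by apply: lt_le_trans m_ge; rewrite powR_gt0.
have m1 : (1 : R) <= m%:R by rewrite ler1n -(ltr0n R).
have gap : m%:R `^ gamma - m%:R `^ l <= - m%:R `^ gamma.
  have -> : l = gamma + (l - gamma) by ring.
  rewrite powRD; last by rewrite (gt_eqF m0) implybT.
  have two : 2 <= m%:R `^ (l - gamma).
    have -> : 2 = (2 `^ (l - gamma)^-1) `^ (l - gamma) :> R.
      by rewrite -powRrM mulVf ?powRr1// gt_eqF.
    by apply: ge0_ler_powR => //; rewrite ?nnegrE ?powR_ge0 ?ler0n// ltW.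
  have := powR_gt0 gamma m0; nra.
rewrite -expRD; apply: (@le_trans _ _ (expR (- m%:R `^ gamma))).
  by rewrite ler_expR.
rewrite expRN -[leRHS]invrK lef_pV2 ?posrE ?expR_gt0 ?invr_gt0 ?divr_gt0 ?exprn_gt0//.
rewrite invf_div; have -> : m%:R `^ gamma = N%:R * (m%:R `^ gamma / N%:R) :> R.
  by rewrite mulrCA divff ?mulr1// gt_eqF.
(* with [y = m `^ gamma], [exp y = exp (y / N) ^ N >= (y / N) ^ N], where
   [y ^ N >= m ^ 2] by the choice of [N] *)
rewrite expRM_natl; apply: (@le_trans _ _ ((m%:R `^ gamma / N%:R) ^+ N)).
  rewrite expr_div_n ler_pM2r ?invr_gt0 ?exprn_gt0//.
  rewrite -!powR_mulrn ?powR_ge0 ?(ltW m0)// -powRrM.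
  exact: ler_powR.
rewrite lerXn2r ?nnegrE ?expR_ge0 ?divr_ge0 ?powR_ge0 ?(ltW N0)//.
by apply: le_trans (expR_ge1Dx _); rewrite lerDr.
Qed.

Lemma inv_sqr_telescope (x : R) : 0 < x -> (1 + x) ^- 2 <= x^-1 - (1 + x)^-1.
Proof.
move=> x0; rewrite -subr_ge0.
have x1 : 0 < 1 + x by rewrite addr_gt0.
have -> : x^-1 - (1 + x)^-1 - (1 + x) ^- 2 = x^-1 * (1 + x) ^- 2.
  by field; rewrite !gt_eqF.
by rewrite mulr_ge0// invr_ge0 ?exprn_ge0// ltW.
Qed.

(** By [expR_stretched_gap] and [n.+1 <= n.+1 + r] the terms are at most a
constant times [(n.+1 + r)^-2], so the sum is at most a constant over [r]. *)
Lemma shifted_sum_small gamma l (C M : R) :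
  0 < gamma -> gamma < l -> 0 < C -> 0 < M ->
  exists r : nat, forall K : nat,
    \sum_(n < K) C * expR (n.+1%:R `^ gamma) * expR (- (n.+1 + r)%:R `^ l) <= M.
Proof.
move=> g0 gl C0 M0; have [A [A0 [m0 bound]]] := expR_stretched_gap g0 gl.
pose r := (m0 + (Num.truncn (C * A / M)).+1)%N.
have r0 : (0 : R) < r%:R by rewrite ltr0n /r; lia.
have rM : C * A / r%:R <= M.
  rewrite ler_pdivrMr// -ler_pdivrMl// [leLHS]mulrC; apply/ltW.
  by apply: lt_le_trans (truncnS_gt _) _; rewrite ler_nat leq_addl.
exists r => K; apply: le_trans rM.
(* the telescoping bound, which allows an induction on [K] *)
suff : \sum_(n < K) C * expR (n.+1%:R `^ gamma) * expR (- (n.+1 + r)%:R `^ l) <=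
    C * A / r%:R - C * A / (K + r)%:R.
  move=> /le_trans; apply; rewrite gerBl divr_ge0// mulr_ge0// ltW//.
elim: K => [|K IHK]; first by rewrite big_ord0 subrr.
rewrite big_ord_recr /=.
suff term : C * expR (K.+1%:R `^ gamma) * expR (- (K.+1 + r)%:R `^ l) <=
    C * A / (K + r)%:R - C * A / (K.+1 + r)%:R.
  by have := lerD IHK term; rewrite addrA subrK.
have x0 : (0 : R) < (K + r)%:R by rewrite ltr0n /r; lia.
have -> : (K.+1 + r)%:R = 1 + (K + r)%:R :> R by rewrite addSn -nat1r.
set x := (K + r)%:R in x0 *.
apply: (@le_trans _ _ (C * (A / (1 + x) ^+ 2))); last first.
  by rewrite mulrA -mulrBr ler_pM2l ?mulr_gt0 ?inv_sqr_telescope.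
rewrite -mulrA ler_pM2l//.
have {1}-> : 1 + x = (K.+1 + r)%:R by rewrite addSn -nat1r.
have -> : 1 + x = (K.+1 + r)%:R by rewrite addSn -nat1r.
apply: le_trans (bound _ _); last by rewrite /r; lia.
rewrite ler_pM2r ?expR_gt0// ler_expR.
by apply: ge0_ler_powR; rewrite ?nnegrE ?ler_nat ?ler0n ?leq_addr// ltW.
Qed.

End StretchedExponential.

(** * Counting with sums *)

Section Counting.
Variables (R : realType) (T : choiceType).
Implicit Types (A : set T) (f : T -> R).

Lemma card_seq (s : seq T) : uniq s -> [set` s] #= `I_(size s).
Proof.
move=> us; have := @card_eq_fsetP T [fset x in s]%fset (size s).
rewrite card_fseq undup_id //; have -> : [set` [fset x in s]%fset] = [set` s].
  by apply/seteqP; split=> x /=; rewrite inE.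
by move=> h; exact/h.
Qed.

Lemma size_card_le (s : seq T) A n :
  uniq s -> (forall x, x \in s -> A x) -> A #<= `I_n -> (size s <= n)%N.
Proof.
move=> us sA An; rewrite -card_le_II.
rewrite -(card_le_eql (card_seq us)).
by apply: card_le_trans An; exact: subset_card_le.
Qed.

(** Markov's inequality for the counting measure. *)
Lemma card_le_esum A B f (c M : R) n :
  finite_set A -> A `<=` B -> 0 < c ->
  (forall e, A e -> c <= f e) -> (\esum_(e in B) (f e)%:E <= M%:E)%E ->
  (M / c < n.+1%:R) -> A #<= `I_n.
Proof.
move=> finA AB c0 cf fM Mn; have [X AX] := finite_fsetP.1 finA.
have eqA : A #= `I_(size X) by rewrite AX card_seq.
rewrite (card_le_eql eqA) card_le_II -ltnS -(ltr_nat R).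
apply: le_lt_trans Mn; rewrite ler_pdivlMr// -lee_fin.
apply: le_trans fM; apply: esum_ge; exists A => //.
rewrite AX -fsbig_seq ?fset_uniq// sumEFin lee_fin mulr_natl.
have -> : c *+ size X = \sum_(e <- X) c.
  by rewrite big_const_seq count_predT iter_addr addr0.
rewrite !big_seq; apply: ler_sum => e eX; apply: cf.
by rewrite AX.
Qed.

Lemma esum_le_seq A f (M : R) :
  (forall s : seq T, uniq s -> (forall e, e \in s -> A e) ->
     \sum_(e <- s) f e <= M) -> (\esum_(e in A) (f e)%:E <= M%:E)%E.
Proof.
move=> bound; apply: ge_ereal_sup => _ [F [finF FA]] <-.
have [X FX] := finite_fsetP.1 finF.
rewrite FX -fsbig_seq ?fset_uniq// sumEFin lee_fin; apply: bound => // e eX.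
by apply: FA; rewrite FX.
Qed.

Lemma esum_le_classes A f (t : T -> nat) (g : nat -> nat) (w : nat -> R) (M : R) :
  (forall e, A e -> f e <= w (t e)) -> (forall n, 0 <= w n) ->
  (forall n, [set e | A e /\ t e = n] #<= `I_(g n)) ->
  (forall K, \sum_(n < K) (g n)%:R * w n <= M) ->
  (\esum_(e in A) (f e)%:E <= M%:E)%E.
Proof.
move=> fw w0 cls sumM; apply: esum_le_seq => s us sA.
pose K := (\max_(e <- s) t e).+1.
apply: le_trans (sumM K).
have -> : \sum_(n < K) (g n)%:R * w n = \sum_(0 <= n < K) (g n)%:R * w n.
  by rewrite big_mkord.
apply: (@le_trans _ _ (\sum_(e <- s) \sum_(0 <= n < K | n == t e) w n)).
  rewrite !big_seq; apply: ler_sum => e es.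
  rewrite big_nat1_eq /= ltnS leq_bigmax_seq // fw //; exact: sA.
under eq_bigr do rewrite big_mkcond /=.
rewrite exchange_big /=; apply: ler_sum => n _.
rewrite -big_mkcond /= big_const_seq iter_addr addr0 -[w n *+ _]mulr_natl.
rewrite ler_wpM2r// ler_nat -size_filter; apply: size_card_le (cls n).
  exact: filter_uniq.
by move=> e; rewrite mem_filter => /andP[/eqP-> /sA].
Qed.

End Counting.

(** * The firefighting game on a tree *)

Section Game.
Variables (V : choiceType) (adj : rel V) (root : V).
Hypothesis tree : is_tree adj.

Local Notation depth := (depth adj root).
Local Notation edges := (edges adj root).
Local Notation ball r := [set v | (depth v <= r)%N].

Lemma protectedP (S : nat -> set V) n v :
  protected S n v <-> exists2 k, (k < n)%N & S k.+1 v.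
Proof.
elim: n => [|n IHn] /=; first by split=> // -[].
split=> [[/IHn[k kn Sk]|Sn]|[k]]; first by exists k => //; exact: ltnW.
  by exists n.
by rewrite ltnS leq_eqVlt => /orP[/eqP->|kn Sk]; [right|left; apply/IHn; exists k].
Qed.

Lemma reach_shallow B r v :
  (forall e, B e -> (r < depth e.2)%N) -> (depth v <= r)%N ->
  reach adj root B root v.
Proof.
move=> deep; move dv : (depth v) => d; elim: d v dv => [|d IHd] v dv dr.
  by rewrite (depth0_root (tree_connected tree) dv); exact: reach_refl.
have [u uv du] := depth_parent (tree_connected tree) dv.
apply: (reachS (IHd u du (ltnW dr))); first by split=> //=; rewrite dv du.
by move=> /deep /=; rewrite dv ltnNge dr.
Qed.

(** * Containing a fire with a cutset *)

Section Containment.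
Variables (pi : set (V * V)) (r : nat).
Hypothesis pi_cut : cutset adj root pi.
Hypothesis pi_deep : forall e, pi e -> (r < depth e.2)%N.

(** The strategy attached to a cutset: a fire born in the ball of radius [r] gets
to depth [n + r] at round [n], which is when the heads at that depth are
protected. *)
Definition guard (n : nat) : set V :=
  [set v | depth v = (n + r)%N /\ exists u, pi (u, v)].

(** The depth bound and the confinement are proved together: the bound shows that
the head of a cut edge is protected before the fire can cross that edge. *)
Lemma fire_guard Z0 n v : Z0 `<=` ball r -> fire adj Z0 guard n v ->
  reach adj root pi root v /\ (depth v <= n + r)%N.
Proof.
move=> Zr; elim: n v => [|n IHn] v /=.
  by move=> /Zr vr; split=> //; exact: reach_shallow vr.
move=> [/IHn[rv dv]|[nprot [u /IHn[ru du] uv]]]; first by split=> //; lia.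
have dv := depth_adj root (tree_connected tree) uv; split; last by lia.
have [euv|evu] := tree_adj root tree uv; last by have [] := reach_parent tree ru evu.
apply: (reachS ru euv) => piuv; apply: nprot.
apply: (protectedP guard n.+1 v).2.
have := pi_deep piuv => /= rdv.
exists (depth v - r).-1; first by lia.
by split; [lia|exists u].
Qed.

Lemma guard_legal g Z0 : Z0 `<=` ball r -> (forall n, guard n.+1 #<= `I_(g n.+1)) ->
  legal adj g Z0 guard.
Proof.
move=> Zr small n; split=> // v [dv _] [/(fire_guard Zr)[_]|]; first by lia.
by move=> /protectedP[k kn [dv' _]]; lia.
Qed.

Lemma guard_contained Z0 : locally_finite adj -> Z0 `<=` ball r ->
  contained adj Z0 guard.
Proof.
move=> lfin Zr; have fin_reach : finite_set (reach adj root pi root).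
  apply: contrapT => /(konig tree lfin)[x rx avoid].
  have [pi_edge /(_ x rx)[e [[pie ex] _]]] := pi_cut.
  have [n en] := (on_ray_edge tree rx (pi_edge _ pie)).1 ex.
  by apply: (avoid n); rewrite -en.
by apply: sub_finite_set fin_reach => v [n _ /(fire_guard Zr)[]].
Qed.

End Containment.

(** * From a contained fire to a cutset *)

Section Escape.
Variables (g : nat -> nat) (S : nat -> set V) (r : nat).
Hypothesis lgl : legal adj g (ball r) S.
Hypothesis cont : contained adj (ball r) S.

Definition guarded_edges : set (V * V) := [set e | exists n, S n.+1 e.2].

Lemma burn n v : reach adj root guarded_edges root v -> (depth v <= n + r)%N ->
  fire adj (ball r) S n v.
Proof.
elim: n v => [|n IHn] v rv dv //=.
have [dv'|dv'] := leqP (depth v) (n + r)%N; first by left; exact: IHn.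
have dvS : depth v = (n + r).+1 by lia.
have [u uv du] := depth_parent (tree_connected tree) dvS.
have euv : edges (u, v) by split=> //=; rewrite dvS du.
have [ru nB] := reach_parent tree rv euv.
right; split; last by exists u => //; apply: IHn => //; rewrite du.
by move=> /((protectedP S n.+1 v).1)[k _ Sk]; apply: nB; exists k.
Qed.

(** A head of smaller depth would, by [burn], have a parent burning soon enough
to ignite it before round [n.+1], and a burning vertex cannot be protected. *)
Lemma guarded_early n e : first_cut adj root guarded_edges e -> S n.+1 e.2 ->
  (n.+1 + r <= depth e.2)%N.
Proof.
case: e => u v [[/= uv dv] ru _] Sv; rewrite leqNgt; apply/negP => late.
have [+ _] := lgl n => /(_ v Sv) []; case: n Sv late => [|n] Sv late.
  by left => /=; lia.
have [prot|nprot] := pselect (protected S n.+1 v); first by right.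
left; right; split=> //; exists u => //; apply: burn => //; lia.
Qed.

(** A ray without guarded edges would burn entirely, so the fire would be
infinite. *)
Lemma guarded_cutset : cutset adj root (first_cut adj root guarded_edges).
Proof.
apply: (first_cut_cutset tree) => x rx; apply: contrapT => avoid.
have [_ _ xinj] := rx.
apply: infinite_nat.
rewrite -(eq_finite_set (inj_card_eq (in2W xinj))).
apply: sub_finite_set cont => _ [n _ <-]; exists n => //; apply: burn.
  by apply/(reach_ray tree) => // m _ Bm; apply: avoid; exists m.
by rewrite (ray_depth tree) ?leq_addr.
Qed.

(** Each edge is charged to the round at which its head is protected; as an edge is
determined by its head, round [n.+1] is charged at most [g n.+1] times. *)
Lemma guarded_cutset_sum (R : realType) (w : nat -> R) (f : V * V -> R) (M : R) :
  (forall n, 0 <= w n) ->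
  (forall n e, (n.+1 + r <= depth e.2)%N -> f e <= w n) ->
  (forall K, \sum_(n < K) (g n.+1)%:R * w n <= M) ->
  (\esum_(e in first_cut adj root guarded_edges) (f e)%:E <= M%:E)%E.
Proof.
move=> w0 fw sumM.
pose t (e : V * V) := xget 0%N [set n | S n.+1 e.2].
have tP e : first_cut adj root guarded_edges e -> S (t e).+1 e.2.
  by move=> [_ _ Be]; exact: (@xgetPex _ 0%N [set n | S n.+1 e.2]).
apply: (@esum_le_classes R _ _ f t (fun n => g n.+1) w) => // [e ce|n].
  by apply: fw; exact: guarded_early (tP e ce).
have inj : {in [set e | first_cut adj root guarded_edges e /\ t e = n] &,
    injective (snd : V * V -> V)}.
  move=> [u v] [u' v'] /set_mem[[e _ _] _] /set_mem[[e' _ _] _] /= vv'.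
  by subst v'; rewrite (parent_uniq tree e e').
rewrite -(card_le_eql (inj_card_eq inj)).
have [_] := lgl n; apply: card_le_trans; apply: subset_card_le.
by move=> _ [e [/tP Se <-] <-].
Qed.

End Escape.

(** * Rates of containment and cutset sums *)

Section Rates.
Variable R : realType.
Hypothesis lfin : locally_finite adj.

Lemma finite_sub_ball (Z : set V) : finite_set Z -> exists r, Z `<=` ball r.
Proof.
move=> /finite_seqP[s ->]; exists (\max_(v <- s) depth v)%N => v /= vs.
exact: leq_bigmax_seq.
Qed.

(** If the cutset sums get arbitrarily small, guarding the heads of a cutset of
sum below [exp (- r^gamma)] stays within the budget [exp (n^gamma)], because
[(n + r)^gamma - r^gamma <= n^gamma]. *)
Lemma containment_of_cutset_inf (gamma : R) : 0 < gamma -> gamma <= 1 ->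
  (cutset_inf adj root gamma <= 0)%E -> intermediate_containment adj gamma.
Proof.
move=> g0 g1 inf0; exists 1, (fun n => Num.truncn (expR (n%:R `^ gamma))); split=> //.
  by move=> n _; rewrite mul1r truncn_le expR_ge0.
move=> Z0 /finite_sub_ball[r Zr].
have [_ [pi cut <-] small] : exists2 y : \bar R,
    [set (\esum_(e in pi) (expR (- ((edge_depth adj root e)%:R `^ gamma)))%:E)%E
      | pi in cutset adj root] y & (y < (expR (- r%:R `^ gamma))%:E)%E.
  by apply: ereal_inf_lt; apply: le_lt_trans inf0 _; rewrite lte_fin expR_gt0.
have deep e : pi e -> (r < depth e.2)%N.
  (* a single edge of depth at most [r] would already outweigh the whole sum *)
  move=> pie; rewrite ltnNge; apply/negP => er.
  have : ((expR (- (edge_depth adj root e)%:R `^ gamma))%:E <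
      (expR (- r%:R `^ gamma))%:E)%E.
    apply: le_lt_trans small; apply: esum_ge; exists [set e].
      by split; [exact: finite_set1|move=> _ ->].
    by rewrite fsbig_set1.
  rewrite lte_fin ltr_expR ltrN2 ltNge => /negP; apply.
  by apply: ge0_ler_powR; rewrite ?nnegrE ?ler0n ?ler_nat// ltW.
exists (guard pi r); split; last exact: guard_contained.
apply: guard_legal => // n.
pose A := [set e | pi e /\ depth e.2 = (n.+1 + r)%N].
have -> : guard pi r n.+1 = snd @` A.
  apply/seteqP; split=> [v [dv [u piuv]]|_ [[u v] [pie dv] <-]].
    by exists (u, v).
  by split=> //; exists u.
apply: card_le_trans (card_image_le _ _) _.
have finA : finite_set A.
  apply: (@sub_finite_set _ _ (ball (n.+1 + r)%N `*` ball (n.+1 + r)%N)).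
    move=> [u v] [piuv /= dv]; have [pi_edge _] := cut.
    by have [/= _] := pi_edge _ piuv; split=> /=; lia.
  by apply: finite_setX; exact: finite_ball.
apply: (card_le_esum finA _ _ _ (ltW small)
  (c := expR (- (n.+1 + r)%:R `^ gamma))) => //.
- by move=> e [].
- by move=> e [_ de]; rewrite /edge_depth de.
apply: le_lt_trans (truncnS_gt _).
rewrite -expRN -expRD ler_expR opprK addrC lerBlDr natrD.
by rewrite powR_subadditive ?ler0n.
Qed.

(** Containing large balls at rate [gamma] produces cutsets of small sum for every
larger exponent: the heads guarded at round [n] lie at depth [n + r] or more. *)
Lemma cutset_inf_of_containment (gamma l : R) : 0 < gamma -> gamma < l ->
  intermediate_containment adj gamma -> (cutset_inf adj root l <= 0)%E.
Proof.
move=> g0 gl [C [g [C0 gC ctn]]]; rewrite leNgt; apply/negP => inf_gt0.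
have [M M0 M_lt] : exists2 M : R, 0 < M & (M%:E < cutset_inf adj root l)%E.
  move: inf_gt0; case: (cutset_inf _ _ _) => [x| |//]; last by exists 1; rewrite ?ltry.
  by rewrite lte_fin => x0; exists (x / 2); rewrite ?lte_fin; lra.
have [r sum_le] := shifted_sum_small g0 gl C0 M0.
have [S [lgl cont]] := ctn _ (finite_ball root tree lfin r).
move: M_lt; rewrite ltNge => /negP; apply.
apply: (@le_trans _ _ (\esum_(e in first_cut adj root (guarded_edges S))
    (expR (- (edge_depth adj root e)%:R `^ l))%:E)%E).
  apply: ereal_inf_lbound; exists (first_cut adj root (guarded_edges S)) => //.
  exact: guarded_cutset cont.
apply: (guarded_cutset_sum lgl (w := fun n => expR (- (n.+1 + r)%:R `^ l))).
- by move=> n; exact: expR_ge0.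
- move=> n e ne; rewrite ler_expR lerN2.
  by apply: ge0_ler_powR; rewrite ?nnegrE ?ler0n ?ler_nat// ltW// (lt_trans g0).
move=> K; apply: le_trans (sum_le K); apply: ler_sum => n _.
by rewrite ler_pM2r ?expR_gt0// gC.
Qed.

End Rates.

End Game.

(** * The critical parameter *)

Theorem theorem6p1 (R : realType) (V : choiceType) (adj : rel V) (root : V)
    (alpha : R)
    (tree : is_tree adj) (lfin : locally_finite adj)
    (Vinf : infinite_set [set: V])
    (alpha_gt0 : 0 < alpha) (alpha_lt1 : alpha < 1)
    (IBN_alpha : IBN adj root R = alpha%:E) :
  (lambda_c adj R)%:E = IBN adj root R /\
  (forall gamma : R, 0 < gamma -> gamma < 1 ->
     (alpha < gamma -> intermediate_containment adj gamma) /\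
     (gamma < alpha -> ~ intermediate_containment adj gamma)).
Proof.
have sup_alpha : ereal_sup [set l%:E | l in [set l : R | 0 < l /\
    (0 < cutset_inf adj root l)%E]] = alpha%:E.
  by move: IBN_alpha; rewrite /IBN /maxe; case: ifP => // _ [] /eqP; rewrite lt_eqF.
have crit : is_critical_parameter adj alpha.
  move=> gamma g0 g1; split=> [ag|ga].
    apply: (containment_of_cutset_inf tree lfin g0 (ltW g1)) => //.
    rewrite leNgt; apply/negP => inf_gt0.
    have : (gamma%:E <= alpha%:E)%E.
      rewrite -sup_alpha; apply: ereal_sup_ubound.
      exists gamma; last reflexivity.
      by split; [exact: g0|exact: inf_gt0].
    by rewrite lee_fin leNgt ag.
  have [|_ [l [l0 inf_gt0] <-]] := @ereal_sup_gt R
    [set l%:E | l in [set l : R | 0 < l /\ (0 < cutset_inf adj root l)%E]] gamma%:E.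
    by rewrite sup_alpha lte_fin.
  rewrite lte_fin => gl /(cutset_inf_of_containment root tree lfin g0 gl).
  by rewrite leNgt inf_gt0.
split=> //; rewrite IBN_alpha; congr (_%:E); apply: xget_unique.
  by split=> //; exact: ltW.
(* the rate halfway between two distinct thresholds gives a contradiction *)
move=> l [l0 l1 lcrit]; apply/eqP; rewrite eq_le !leNgt; apply/andP; split.
  apply/negP => al; have [||_ no] := lcrit ((alpha + l) / 2); [lra|lra|].
  apply: no; first by lra.
  by have [||+ _] := crit ((alpha + l) / 2); [lra|lra|apply; lra].
apply/negP => la; have [||yes _] := lcrit ((alpha + l) / 2); [lra|lra|].
have [||_ +] := crit ((alpha + l) / 2); [lra|lra|apply; first by lra].
by apply: yes; lra.
Qed.
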